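(* Let $z=x+iy$ with $y>0$, let $\mu_z\in\mathbb R$, put $\widehat z:=z-\mu_z$, and assume that $\zeta:=\arg\widehat z\in(\tfrac12\pi,\pi)$. Let $B_z$ be a positive definite Hermitian operator on $V$ such that, for some positive $m_z,M_z$, $$m_z(B_z^{-1}v,v)\le((\mu_zI+A)v,v)\le M_z(B_z^{-1}v,v),\quad\forall v\in V.$$ Put $G_z:=B_z(zI+A)$, $\Lambda_z:=|\widehat z|\,\|B_z\|$ and $J:=(\zeta-\tfrac12\pi,\tfrac12\pi)$. Let $\varphi_z$ be the value in $J$ that maximizes $$\nu_z(\varphi):=\frac{m_z\cos^2\varphi\,\cos(\zeta-\varphi)}{M_z\cos(\zeta-\varphi)+\Lambda_z\cos\varphi},$$ and set $\rho_z:=\nu_z(\varphi_z)/(m_z\cos\varphi_z)$ and $\alpha_z:=\rho_ze^{-i\varphi_z}$. Then $$|[I-\alpha_zG_z]|\le\widehat\varepsilon_z:=\bigl(1-\nu_z(\varphi_z)\bigr)^{1/2}.$$ If, in addition, there is a $\gamma_z\ge0$ such that $$\operatorname{Re}\bigl(\widehat z\,[B_zv,B_z(\mu_zI+A)v]\bigr)\le-\gamma_z[B_zv,v],\quad\forall v\in V,$$ let $\breve\varphi_z$ be the value in $J$ that maximizes $$\breve\nu_z(\varphi):=\frac{m_z\cos^2\varphi\,\cos(\zeta-\varphi)}{\max\bigl(M_z\cos(\zeta-\varphi),\breve\Lambda_z\cos\varphi\bigr)},\qquad\breve\Lambda_z:=\Lambda_z-\frac{2\gamma_z}{|\widehat z|},$$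 and put $\breve\rho_z:=\breve\nu_z(\breve\varphi_z)/(m_z\cos\breve\varphi_z)$ and $\breve\alpha_z:=\breve\rho_ze^{-i\breve\varphi_z}$. Then we have the sharper estimate $$|[I-\breve\alpha_zG_z]|\le\breve\varepsilon_z:=\bigl(1-\breve\nu_z(\breve\varphi_z)\bigr)^{1/2}$$ (sharper in the sense that $\breve\varepsilon_z\le\widehat\varepsilon_z$).
   Context: $V$ is a finite-dimensional complex inner product space with inner product $(\cdot,\cdot)$ (linear in the first argument), norm $\|\cdot\|$ and induced operator norm $\|\cdot\|$; $A$ is a positive definite Hermitian operator on $V$. Define $[v,w]:=(B_z^{-1}v,w)$ and $|[v]|:=[v,v]^{1/2}$; for an operator $T$ on $V$, $|[T]|$ denotes the operator norm induced by $|[\cdot]|$. The quantity $|[I-\alpha G_z]|$ is the error reduction factor of the preconditioned Richardson iteration $w^{n+1}=(I-\alpha G_z)w^n+\alpha B_zg$ for $(zI+A)w=g$. *)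

(* Defs.v *)
From HB Require Import structures.
From mathcomp Require Import all_boot all_order all_algebra.
From mathcomp Require Import all_classical all_reals all_analysis.
From mathcomp Require Import complex.

Set Implicit Arguments.
Unset Strict Implicit.
Unset Printing Implicit Defensive.

Import Order.TTheory GRing.Theory Num.Theory.

Local Open Scope classical_set_scope.
Local Open Scope complex_scope.
Local Open Scope ring_scope.

Section ComplexNumbers.
Context {R : realType}.

(* `|w| has type R[i], with imaginary part 0. *)
Definition cabs (w : R[i]) : R := complex.Re `|w|.

Definition expi (t : R) : R[i] := cos t +i* sin t.

(* The principal argument, in ]-pi, pi] (see cargP); meaningless at w = 0. *)
Definition carg (w : R[i]) : R :=
  let t := acos (complex.Re w / cabs w) in
  if 0 <= complex.Im w then t else - t.

Lemma cabsE (w : R[i]) :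
  cabs w = Num.sqrt (complex.Re w ^+ 2 + complex.Im w ^+ 2).
Proof. by case: w => a b; rewrite /cabs normc_def. Qed.

Lemma cargP (w : R[i]) : w != 0 ->
  - pi < carg w <= pi /\ w = (cabs w)%:C * expi (carg w).
Proof.
case: w => a b; rewrite eq_complex /= => nz.
have r2 : 0 < a ^+ 2 + b ^+ 2.
  rewrite lt_def addr_ge0 ?sqr_ge0 // andbT paddr_eq0 ?sqr_ge0 //.
  by rewrite !sqrf_eq0.
rewrite /carg cabsE /=; set r := Num.sqrt _.
have r0 : 0 < r by rewrite sqrtr_gt0.
have rn0 : r != 0 by rewrite gt_eqF.
have rr : r ^+ 2 = a ^+ 2 + b ^+ 2 by rewrite sqr_sqrtr // ltW.
have cr : 1 - (a / r) ^+ 2 = (b / r) ^+ 2.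
  rewrite !expr_div_n rr -[X in X - _](@divff _ (a ^+ 2 + b ^+ 2)) ?gt_eqF //.
  by rewrite -mulrBl addrAC subrr add0r.
have c1 : -1 <= a / r <= 1.
  rewrite -ler_norml -(@ler_pXn2r _ 2) ?nnegrE // expr1n.
  by rewrite real_normK ?num_real // -subr_ge0 cr sqr_ge0.
have [/andP[t0 tpi] ct] := acos_def c1.
have st : sin (acos (a / r)) = `|b| / r.
  by rewrite sin_acos // cr sqrtr_sqr normrM normfV (gtr0_norm r0).
have pi0 : - pi < 0 :> R by rewrite oppr_lt0 pi_gt0.
have [b0|b0] := leP 0 b; split.
- by rewrite tpi andbT (lt_le_trans pi0).
- rewrite /expi ct st ger0_norm //.
  by apply/eqP; rewrite eq_complex /= !mul0r subr0 addr0 !mulrA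
    ![r * _]mulrC !mulfK // !eqxx.
- rewrite ltrN2 acos_ltpi ?(le_trans _ (pi_ge0 R)) ?oppr_le0 //.
  case/andP: c1 => c1 ->; rewrite andbT lt_neqAle c1 andbT.
  apply/eqP => e; move: cr; rewrite -e sqrrN expr1n subrr => /esym/eqP.
  by rewrite sqrf_eq0 mulf_eq0 invr_eq0 (negbTE rn0) orbF lt_eqF.
- rewrite /expi cosN sinN ct st ltr0_norm // mulNr opprK.
  by apply/eqP; rewrite eq_complex /= !mul0r subr0 addr0 !mulrA
    ![r * _]mulrC !mulfK // !eqxx.
Qed.

End ComplexNumbers.

Section InnerProduct.
Context {R : realType} {V : vectType R[i]}.
Implicit Types (f : V -> V -> R[i]) (T : 'End(V)).

Definition posdef_hermitian f T :=
  (forall v w, f (T v) w = f v (T w)) /\ (forall v, v != 0 -> 0 < f (T v) v).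

Definition form_norm f (v : V) : R := Num.sqrt (complex.Re (f v v)).

Definition op_norm f T : R :=
  sup [set form_norm f (T v) | v in [set v | form_norm f v <= 1]].

(* [v, w] = (B^-1 v, w) *)
Definition inv_form f (B : 'End(V)) (v w : V) : R[i] := f ((B^-1)%VF v) w.

End InnerProduct.

Section StepSize.
Context {R : realType}.
Implicit Types m M L zeta phi : R.

Definition is_maximizer (J : set R) (h : R -> R) (phi : R) :=
  J phi /\ forall psi, J psi -> h psi <= h phi.

Definition nu m M L zeta phi : R :=
  m * cos phi ^+ 2 * cos (zeta - phi) /
  (M * cos (zeta - phi) + L * cos phi).

Definition nu_breve m M L zeta phi : R :=
  m * cos phi ^+ 2 * cos (zeta - phi) /
  Num.max (M * cos (zeta - phi)) (L * cos phi).

End StepSize.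

(* Main.v *)
Require Import Defs.
From HB Require Import structures.
From mathcomp Require Import all_boot all_order all_algebra.
From mathcomp Require Import all_classical all_reals all_analysis.
From mathcomp Require Import complex ring lra.

(** Write c for z - mu, K for mu I + A and q(u, w) for (B u, w).  Then
    G = B (c I + K), and for v = B w the vector (I - alpha G) v is
    B (w - alpha g) with g = c v + K v, so that
<<
  |[(I - alpha G) v]|^2 = |[v]|^2 - 2 Re (alpha (g, v)) + |alpha|^2 q(g, g).
>>
    Put X = |c| (v, v), Y = (K v, v), zeta = arg c, c1 = cos (zeta - phi) and
    c2 = cos phi; both cosines are positive on J.  With
    alpha = rho exp (- i phi) the middle term is - 2 rho (c1 X + c2 Y).  If D
    is any positive number such that c1 c2 q(g, g) <= D (c1 X + c2 Y) for all
    v, then the choice rho = c1 c2 / D leaves at most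
    |[v]|^2 - rho (c1 X + c2 Y), and Y >= m |[v]|^2, X >= 0 give the factor
    1 - rho m c2 (lemma [op_norm_richardson_le]).

    It remains to bound q(g, g) = Q + W + P, where P = |c|^2 q(v, v),
    Q = q(K v, K v) and W = 2 Re (c q(v, K v)).  One has P <= Lambda X
    ([posdef_le_op_norm]) and Q <= M Y ([preconditioned_sqr_le]).  Without
    further information, Young's inequality for W with the optimal weight
    yields D = M c1 + Lambda c2 ([sum_sq_le]); with the gamma condition,
    W <= - (2 gamma / |c|) X yields D = max (M c1, Lambda' c2) with the reduced
    constant Lambda' = Lambda - 2 gamma / |c|.  The second value of D is at most
    the first for every phi, whence the comparison of the maxima.

    The operator norm is a supremum of real numbers, which controls the
    operator only when the set is bounded; this is where the finite dimension
    of V enters ([bounded_end]). *)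

Set Implicit Arguments.
Unset Strict Implicit.
Unset Printing Implicit Defensive.

Import Order.TTheory GRing.Theory Num.Theory.

Local Open Scope classical_set_scope.
Local Open Scope complex_scope.
Local Open Scope ring_scope.

(** * Hermitian operators and inner products *)

Section DotForms.
Context {R : realType} {V : vectType R[i]} (ip : {dot V for Num.conj}).
Implicit Types (S T : 'End(V)) (u v w : V) (a : R[i]).

Lemma dot_conj u v : ip u v = (ip v u)^*.
Proof. by rewrite (hermC ip u v) /= expr0 mul1r. Qed.

Lemma Re_conj a : complex.Re a^* = complex.Re a.
Proof. by case: a. Qed.

Lemma ReD (a b : R[i]) : complex.Re (a + b) = complex.Re a + complex.Re b.
Proof. by case: a b => [? ?] [? ?]. Qed.

Lemma ReZ (k : R) a : complex.Re (k%:C * a) = k * complex.Re a.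
Proof. by case: a => ? ? /=; rewrite mul0r subr0. Qed.

Lemma Re_ge0 (a : R[i]) : 0 <= a -> 0 <= complex.Re a.
Proof. by rewrite lecE => /andP[]. Qed.

Lemma dot_ge0 v : 0 <= complex.Re (ip v v).
Proof. exact/Re_ge0/dnorm_ge0. Qed.

Lemma cabs_ge0 a : 0 <= cabs a.
Proof. by rewrite cabsE sqrtr_ge0. Qed.

Lemma sqr_cabs a : (cabs a ^+ 2)%:C = a * a^*.
Proof.
case: a => p q; rewrite cabsE sqr_sqrtr ?addr_ge0 ?sqr_ge0 //=.
by apply/eqP; rewrite eq_complex /=; apply/andP; split; apply/eqP; ring.
Qed.

Lemma cabsN a : cabs (- a) = cabs a.
Proof. by rewrite /cabs normrN. Qed.

Lemma cabs_polar (k t : R) : 0 <= k -> cabs (k%:C * expi t) = k.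
Proof.
move=> k0; rewrite cabsE /= !mul0r subr0 addr0 !exprMn -mulrDr cos2Dsin2.
by rewrite mulr1 sqrtr_sqr ger0_norm.
Qed.

(** Used with S = B for residuals, for q(g, g) and for Young's inequality, and
    with S = K for the bound Q <= M Y. *)
Lemma hermitian_expand S u v a :
  (forall v w, ip (S v) w = ip v (S w)) ->
  complex.Re (ip (S (u + a *: v)) (u + a *: v)) =
  complex.Re (ip (S u) u) + 2 * complex.Re (a * ip (S v) u) +
  cabs a ^+ 2 * complex.Re (ip (S v) v).
Proof.
move=> hS.
have -> : ip (S (u + a *: v)) (u + a *: v) =
  ip (S u) u + (a * ip (S v) u)^* + a * ip (S v) u +
  (cabs a ^+ 2)%:C * ip (S v) v.
  have -> : S (u + a *: v) = S u + a *: S v by rewrite linearD linearZ.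
  rewrite linearDl !linearDr !linearZl_LR !linearZr_LR /=.
  rewrite rmorphM sqr_cabs /=.
  by rewrite -(dot_conj u (S v)) !hS -[_ *: _]/(_ * _); ring.
by rewrite !ReD Re_conj ReZ; ring.
Qed.

Lemma posdef_ge0 S v : posdef_hermitian ip S -> 0 <= complex.Re (ip (S v) v).
Proof.
move=> [_ S0]; have [->|/S0/ltW/Re_ge0//] := eqVneq v 0.
by rewrite linear0r.
Qed.

Lemma posdef_gt0 S v : posdef_hermitian ip S -> v != 0 ->
  0 < complex.Re (ip (S v) v).
Proof. by move=> [_ S0] /S0; rewrite ltcE => /andP[]. Qed.

Lemma posdef_lker0 S : posdef_hermitian ip S -> lker S == 0%VS.
Proof.
move=> [_ S0]; rewrite -subv0; apply/subvP => v; rewrite memv_ker memv0.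
move=> /eqP Sv; apply: contraT => /S0.
by rewrite Sv linear0l ltxx.
Qed.

Lemma dnormD_le u v : ip (u + v) (u + v) <= 2 * (ip u u + ip v v).
Proof.
rewrite -subr_ge0 (_ : _ - _ = ip (u - v) (u - v)) ?dnorm_ge0 //.
by rewrite dnormB dnormD; ring.
Qed.

(** Operators are bounded on the span of a finite family: the family is enlarged
    one vector at a time, the new vector being replaced by its component
    orthogonal to the previous ones. *)
Lemma bounded_span T (s : seq V) : exists2 C : R[i], 0 <= C &
  forall v, v \in << s >>%VS -> ip (T v) (T v) <= C * ip v v.
Proof.
elim: s => [|x s [C C0 IH]].
  exists 0 => // v; rewrite span_nil memv0 => /eqP->.
  by rewrite linear0 linear0l mul0r.
(* x = p + q with p in the span of s and q orthogonal to it. *)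
have [p ps [q [xE _ qs]]] := orthogonal_split ip s x.
pose K := ip (T q) (T q) / ip q q.
have K0 : 0 <= K by rewrite divr_ge0 ?dnorm_ge0.
(* For q = 0 the quotient K is 0, and the equation still holds. *)
have KE : ip (T q) (T q) = K * ip q q.
  rewrite /K; have [->|q0] := eqVneq q 0.
    by rewrite linear0 linear0l mulr0.
  by rewrite divfK ?dnorm_eq0.
exists (2 * (K + C)) => [|v]; first by rewrite mulr_ge0 ?addr_ge0.
rewrite span_cons => /memv_addP[_ /vlineP[a ->] [t ts ->]].
have -> : a *: x + t = a *: q + (a *: p + t).
  by rewrite xE scalerDr addrA [a *: p + _]addrC.
have ws : a *: p + t \in << s >>%VS by rewrite memvD ?memvZ.
move: (a *: p + t) ws => w ws.
have qw : ip (a *: q) w = 0.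
  rewrite linearZl_LR /=.
  by rewrite (@span_orthogonal _ _ ip [:: q] s) ?mulr0 ?memv_span1.
have TE : T (a *: q + w) = a *: T q + T w by rewrite linearD linearZ.
have -> : ip (a *: q + w) (a *: q + w) = `|a| ^+ 2 * ip q q + ip w w.
  by rewrite -(dnormZ ip a q) hnormDd.
rewrite TE (le_trans (dnormD_le _ _)) // -mulrA ler_pM2l // dnormZ KE.
rewrite mulrDr mulrDl -addrA lerD //; first by rewrite mulrCA.
rewrite -[leLHS]add0r lerD //; first by rewrite !mulr_ge0 ?dnorm_ge0.
by rewrite (le_trans (IH _ ws)) // mulrDl lerDr mulr_ge0 ?dnorm_ge0.
Qed.

End DotForms.
(** * The operator norm *)

Section OperatorNorm.
Context {R : realType} {V : vectType R[i]} (ip : {dot V for Num.conj}).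
Implicit Types (S T : 'End(V)) (u v w : V).

Lemma op_norm_le (f : V -> V -> R[i]) T (c : R) : f 0 0 = 0 ->
  (forall v, form_norm f v <= 1 -> form_norm f (T v) <= c) ->
  op_norm f T <= c.
Proof.
move=> f0 fT; apply: ge_sup => [|_ [v /fT Tv <-]//].
by exists (form_norm f (T 0)), 0 => //=; rewrite /form_norm f0 sqrtr0.
Qed.

Lemma bounded_end T : exists2 C : R, 0 <= C &
  forall v, complex.Re (ip (T v) (T v)) <= C * complex.Re (ip v v).
Proof.
have [C C0 CT] := bounded_span ip T (vbasis fullv).
exists (complex.Re C) => [|v]; first exact: Re_ge0.
have := CT v; rewrite (span_basis (vbasisP _)) memvf => /(_ isT).
rewrite lecE => /andP[_ /le_trans]; apply; move: C0 (dnorm_ge0 ip v).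
rewrite !lecE; case: C {CT} (ip v v) => [p q] [r s] /= /andP[/eqP-> _] _.
by rewrite mul0r subr0.
Qed.

Lemma op_norm_ub T v : form_norm ip v <= 1 ->
  form_norm ip (T v) <= op_norm ip T.
Proof.
move=> v1; have [C C0 CT] := bounded_end T.
apply: ub_le_sup; last by exists v.
exists (Num.sqrt C) => _ [w /= w1 <-]; rewrite ler_sqrt //.
rewrite (le_trans (CT w)) // ler_piMr //.
by move: w1; rewrite -{1}sqrtr1 ler_sqrt.
Qed.

Lemma op_norm_ge v T :
  form_norm ip (T v) <= op_norm ip T * form_norm ip v.
Proof.
have [->|v0] := eqVneq v 0.
  by rewrite linear0 /form_norm linear0l sqrtr0 mulr0.
have n0 : 0 < form_norm ip v.
  rewrite sqrtr_gt0; have := dnorm_gt0 ip v.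
  by rewrite v0 ltcE => /andP[].
pose k := (form_norm ip v)^-1.
have normZ w : form_norm ip (k%:C *: w) = k * form_norm ip w.
  have k0 : 0 <= k by rewrite invr_ge0 ltW.
  have kE : complex.Re (ip (k%:C *: w) (k%:C *: w)) =
            k ^+ 2 * complex.Re (ip w w).
    rewrite -ReZ dnormZ; congr (complex.Re (_ * _)).
    rewrite normc_def /= expr0n addr0 sqrtr_sqr ger0_norm //.
    by rewrite rmorphXn.
  by rewrite /form_norm kE sqrtrM ?sqr_ge0 // sqrtr_sqr ger0_norm.
rewrite -(ler_pdivrMr _ _ n0) mulrC -/k -normZ -linearZ; apply: op_norm_ub.
by rewrite normZ mulVf ?gt_eqF.
Qed.

Lemma op_norm_ge0 T : 0 <= op_norm ip T.
Proof.
apply: le_trans (@op_norm_ub T 0 _) => [|/=]; first exact: (sqrtr_ge0 _).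
by rewrite /form_norm linear0l sqrtr0.
Qed.

Lemma dotE v : ip v v = (complex.Re (ip v v))%:C.
Proof.
have := dnorm_ge0 ip v; rewrite lecE => /andP[/eqP im _].
by apply/eqP; rewrite eq_complex /= im !eqxx.
Qed.

Lemma CauchySchwarz_Re u v :
  complex.Re (ip u v) ^+ 2 <= complex.Re (ip u u) * complex.Re (ip v v).
Proof.
have [CS _] := CauchySchwarz ip u v; move: CS.
rewrite (dotE u) (dotE v) normCK -sqr_cabs -rmorphM lecR; apply: le_trans.
by rewrite cabsE sqr_sqrtr ?addr_ge0 ?sqr_ge0 // lerDl sqr_ge0.
Qed.

(** Multiplied by |c|^2, this is P <= Lambda X. *)
Lemma posdef_le_op_norm S v : posdef_hermitian ip S ->
  complex.Re (ip (S v) v) <= op_norm ip S * complex.Re (ip v v).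
Proof.
move=> S0; have nE w : form_norm ip w ^+ 2 = complex.Re (ip w w).
  by rewrite sqr_sqrtr // dot_ge0.
have vv0 := dot_ge0 ip v; have n0 := op_norm_ge0 S.
rewrite -(@ler_pXn2r _ 2) ?nnegrE ?mulr_ge0 ?posdef_ge0 //.
rewrite (le_trans (CauchySchwarz_Re _ _)) // exprMn [X in _ <= _ * X]expr2.
rewrite mulrA ler_wpM2r // -!nE -exprMn.
by rewrite lerXn2r ?nnegrE ?mulr_ge0 ?sqrtr_ge0 // op_norm_ge.
Qed.

End OperatorNorm.
(** * The Richardson iteration *)

Section Richardson.
Context {R : realType} {V : vectType R[i]} (ip : {dot V for Num.conj}).
Context (B K : 'End(V)) (B0 : posdef_hermitian ip B).
Implicit Types (v w : V) (a c : R[i]).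

Lemma inv_formB v w : inv_form ip B (B v) w = ip v w.
Proof. by rewrite /inv_form lker0_lfunK // (posdef_lker0 B0). Qed.

Lemma inv_form_ge0 v : 0 <= complex.Re (inv_form ip B v v).
Proof.
have [w ->] : exists w, v = B w.
  by exists (B^-1%VF v); rewrite lker0_lfunVK // (posdef_lker0 B0).
by rewrite inv_formB -(proj1 B0) posdef_ge0.
Qed.

(** If 0 <= B K <= M for the form [.,.], then (B K)^2 <= M B K.  The optimal
    test vector in the positive form (K ., .) is v - (B K v) / M. *)
Lemma preconditioned_sqr_le (M : R) v :
  (forall v w, ip (K v) w = ip v (K w)) ->
  (forall v, 0 <= complex.Re (ip (K v) v)) ->
  0 < M ->
  (forall v, complex.Re (ip (K v) v) <=
             M * complex.Re (inv_form ip B v v)) ->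
  complex.Re (ip (B (K v)) (K v)) <= M * complex.Re (ip (K v) v).
Proof.
move=> hK K0 M0 KM; set Q := complex.Re (ip (B _) _).
have KQ : complex.Re (ip (K (B (K v))) (B (K v))) <= M * Q.
  by rewrite (le_trans (KM _)) // inv_formB -(proj1 B0).
have := K0 (v + (- M^-1)%:C *: B (K v)).
rewrite hermitian_expand // ReZ (hK (B (K v))) -/Q.
have -> : cabs (- M^-1)%:C ^+ 2 = M^-1 ^+ 2.
  by rewrite cabsE /= expr0n addr0 sqrtr_sqr normrN real_normK ?num_real.
move: (complex.Re (ip (K v) v)) (complex.Re _) KQ => Y Z ZQ.
have : M^-1 ^+ 2 * Z <= M^-1 * Q.
  rewrite expr2 -mulrA ler_wpM2l ?invr_ge0 ?(ltW M0) //.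
  by rewrite mulrC ler_pdivrMr // mulrC.
move=> h1 h2; rewrite -ler_pdivrMl //; lra.
Qed.

(** The squared norm of (I - a G) v, where G = B (c I + K). *)
Lemma inv_form_residual v a c : let g := c *: v + K v in
  let r := (\1%VF - a *: (B \o (c *: \1 + K)))%VF v in
  complex.Re (inv_form ip B r r) =
  complex.Re (inv_form ip B v v) - 2 * complex.Re (a * ip g v) +
  cabs a ^+ 2 * complex.Re (ip (B g) g).
Proof.
move=> g r; have Bv := lker0_lfunVK (posdef_lker0 B0) v.
set w := (B^-1)%VF v in Bv.
have -> : r = B (w + (- a) *: g).
  have -> : B (w + - a *: g) = B w + - a *: B g by rewrite linearD linearZ.
  rewrite Bv scaleNr /r /g.
  rewrite !(add_lfunE, opp_lfunE, scale_lfunE, comp_lfunE, id_lfunE).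
  by [].
rewrite inv_formB -(proj1 B0) hermitian_expand; last exact: (proj1 B0).
rewrite cabsN mulNr raddfN /= (proj1 B0) Bv -[v in inv_form _ _ v]Bv inv_formB.
by rewrite (proj1 B0) Bv mulrN.
Qed.

(** The contraction estimate for an arbitrary bound D of q(g, g) relative to
    c1 X + c2 Y; here k and zeta are the modulus and the argument of c. *)
Lemma op_norm_richardson_le (m D k zeta phi : R) :
  let c1 := cos (zeta - phi) in let c2 := cos phi in
  let c := k%:C * expi zeta in
  let n := m * c2 ^+ 2 * c1 / D in
  0 < c1 -> 0 < c2 -> 0 < D -> 0 < m -> 0 <= k ->
  (forall v w, ip (K v) w = ip v (K w)) ->
  (forall v, m * complex.Re (inv_form ip B v v) <= complex.Re (ip (K v) v)) ->
  (forall v, c1 * c2 * complex.Re (ip (B (c *: v + K v)) (c *: v + K v)) <=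
     D * (c1 * (k * complex.Re (ip v v)) + c2 * complex.Re (ip (K v) v))) ->
  op_norm (inv_form ip B)
    (\1%VF - ((n / (m * c2))%:C * expi (- phi)) *:
       (B \o (c *: \1 + K))%VF) <= Num.sqrt (1 - n).
Proof.
move=> c1 c2 c n c10 c20 D0 m0 k0 hK Km KD.
set rho := n / (m * c2); have rE : rho = c1 * c2 / D.
  by rewrite /rho /n; field; rewrite !gt_eqF.
have nE : n = rho * (m * c2) by rewrite /rho divfK // mulf_neq0 ?gt_eqF.
have rho0 : 0 <= rho by rewrite rE !mulr_ge0 ?invr_ge0 ?ltW.
apply: op_norm_le => [|v]; first by rewrite /inv_form !linear0r.
rewrite /form_norm -{1}sqrtr1 ler_sqrt // => v1.
rewrite inv_form_residual cabs_polar //.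
have := KD v; have := Km v; have := inv_form_ge0 v.
have -> : complex.Re (rho%:C * expi (- phi) * ip (c *: v + K v) v) =
  rho * (c1 * (k * complex.Re (ip v v)) + c2 * complex.Re (ip (K v) v)).
  rewrite -mulrA ReZ; congr (rho * _).
  rewrite linearDl linearZl_LR /= (dotE ip v) /c.
  have /eqP := dot_conj ip (K v) v; rewrite -hK eq_complex /= => /andP[_ /eqP].
  case: (ip (K v) v) => Y Z /= Zn; have -> : Z = 0 by lra.
  by rewrite /c1 cosB cosN sinN -/c2; ring.
have := dot_ge0 ip v; move: v1; move: (complex.Re (ip (B _) _)) (complex.Re (ip v v)) => Gg vv.
move: (complex.Re (inv_form _ _ _ _)) (complex.Re (ip (K v) v)) => N Y.
move=> N1 vv0 N0 KN KE; set E := c1 * _ + _ in KE *.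
have EN : n * N <= rho * E.
  rewrite nE -mulrA ler_wpM2l // mulrAC mulrC /E.
  by rewrite ler_wpDl ?ler_wpM2l ?mulr_ge0 // ltW.
have GE : rho ^+ 2 * Gg <= rho * E.
  rewrite expr2 -mulrA ler_wpM2l // rE mulrAC ler_pdivrMr //.
  by rewrite [leRHS]mulrC.
have le1 : N - 2 * (rho * E) + rho ^+ 2 * Gg <= (1 - n) * N by lra.
(* When 1 - n < 0, both square roots are those of nonpositive numbers, hence
   zero. *)
have [n1|n1] := leP 0 (1 - n).
  by rewrite ler_sqrt // (le_trans le1) // ler_piMr.
rewrite ler0_sqrtr ?sqrtr_ge0 // (le_trans le1) // mulr_le0_ge0 //.
exact: ltW.
Qed.

End Richardson.
(** * Bounds for the quadratic term *)

Section QuadraticBounds.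
Context {R : realType} {V : vectType R[i]} (ip : {dot V for Num.conj}).
Context (B : 'End(V)) (B0 : posdef_hermitian ip B).
Implicit Types (u v w : V) (c : R[i]).

(** Positivity of the form (B ., .) at w - s c v. *)
Lemma young_cross_term (s : R) v w c :
  s * (2 * complex.Re (c * ip (B v) w)) <=
  complex.Re (ip (B w) w) + s ^+ 2 * (cabs c ^+ 2 * complex.Re (ip (B v) v)).
Proof.
have := posdef_ge0 (w + (- (s%:C * c)) *: v) B0.
rewrite (hermitian_expand _ _ _ (proj1 B0)) cabsN mulNr raddfN /= -mulrA ReZ.
have -> : cabs (s%:C * c) ^+ 2 = s ^+ 2 * cabs c ^+ 2.
  by case: c => p q; rewrite !cabsE !sqr_sqrtr ?addr_ge0 ?sqr_ge0 //=; ring.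
lra.
Qed.

Lemma image_sq v w c :
  complex.Re (ip (B (c *: v + w)) (c *: v + w)) =
  complex.Re (ip (B w) w) + 2 * complex.Re (c * ip (B v) w) +
  cabs c ^+ 2 * complex.Re (ip (B v) v).
Proof. by rewrite addrC (hermitian_expand _ _ _ (proj1 B0)). Qed.

End QuadraticBounds.

(** The hypothesis on W is used for the weight s = M c1 / (L c2), the one that
    makes the bound on Q + W + P a multiple of M c1 P + L c2 Q. *)
Lemma sum_sq_le (R : realType) (c1 c2 L M P Q W X Y : R) :
  0 < c1 -> 0 < c2 -> 0 < L -> 0 < M -> P <= L * X -> Q <= M * Y ->
  (forall s, s * W <= Q + s ^+ 2 * P) ->
  c1 * c2 * (Q + W + P) <= (M * c1 + L * c2) * (c1 * X + c2 * Y).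
Proof.
move=> c10 c20 L0 M0 PX QY WPQ.
have d0 : 0 < L * c2 by rewrite mulr_gt0.
have e0 : 0 < M * c1 by rewrite mulr_gt0.
have young : (L * c2) * (M * c1) * W <= (L * c2) ^+ 2 * Q + (M * c1) ^+ 2 * P.
  have -> : L * c2 * (M * c1) * W = (L * c2) ^+ 2 * (M * c1 / (L * c2) * W).
    by field; rewrite !gt_eqF.
  have -> : (L * c2) ^+ 2 * Q + (M * c1) ^+ 2 * P =
            (L * c2) ^+ 2 * (Q + (M * c1 / (L * c2)) ^+ 2 * P).
    by field; rewrite !gt_eqF.
  by rewrite ler_wpM2l ?sqr_ge0.
rewrite -(ler_pM2l (mulr_gt0 L0 M0)).
have -> : L * M * (c1 * c2 * (Q + W + P)) = L * c2 * (M * c1) * (Q + P) +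
          L * c2 * (M * c1) * W by ring.
have PX' : M * c1 * P <= M * c1 * (L * X) by rewrite ler_wpM2l ?(ltW e0).
have QY' : L * c2 * Q <= L * c2 * (M * Y) by rewrite ler_wpM2l ?(ltW d0).
apply: (@le_trans _ _ ((M * c1 + L * c2) * (M * c1 * P + L * c2 * Q))).
  rewrite (le_trans (lerD (lexx _) young)) // le_eqVlt; apply/orP; left.
  by apply/eqP; ring.
have -> : L * M * ((M * c1 + L * c2) * (c1 * X + c2 * Y)) =
  (M * c1 + L * c2) * (M * c1 * (L * X) + L * c2 * (M * Y)) by ring.
by rewrite ler_wpM2l ?lerD // addr_ge0 // ltW.
Qed.

(** * The error reduction factors *)

Theorem theorem2p4 (R : realType) (V : vectType R[i])
    (ip : {dot V for Num.conj}) (A B : 'End(V)) (x y mu m M phi : R) :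
  let z : R[i] := x +i* y in
  let zhat : R[i] := z - mu%:C in
  let zeta := carg zhat in
  let I : 'End(V) := \1%VF in
  let Amu : 'End(V) := mu%:C *: I + A in
  let bip := inv_form ip B in
  let G : 'End(V) := (B \o (z *: I + A))%VF in
  let L := cabs zhat * op_norm ip B in
  let J : set R := [set` `]zeta - pi / 2, pi / 2[] in
  let nuz := nu m M L zeta in
  let rho := nuz phi / (m * cos phi) in
  let alpha := rho%:C * expi (- phi) in
  let eps := Num.sqrt (1 - nuz phi) in
  posdef_hermitian ip A ->
  0 < y ->
  pi / 2 < zeta < pi ->
  posdef_hermitian ip B ->
  0 < m -> 0 < M ->
  (forall v, m%:C * bip v v <= ip (Amu v) v <= M%:C * bip v v) ->
  is_maximizer J nuz phi ->
  op_norm bip (I - alpha *: G) <= eps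
  /\
  forall gamma phib : R,
    let Lb := L - 2 * gamma / cabs zhat in
    let nub := nu_breve m M Lb zeta in
    let rhob := nub phib / (m * cos phib) in
    let alphab := rhob%:C * expi (- phib) in
    let epsb := Num.sqrt (1 - nub phib) in
    0 <= gamma ->
    (forall v, complex.Re (zhat * bip (B v) (B (Amu v)))
                 <= - gamma * complex.Re (bip (B v) v)) ->
    is_maximizer J nub phib ->
    op_norm bip (I - alphab *: G) <= epsb /\ epsb <= eps.
Proof.
move=> z zhat zeta I Amu bip G L J nuz rho alpha eps hA y0 zeta_bd hB m0 M0
  bounds [Jphi phi_max].
have hK v w : ip (Amu v) w = ip v (Amu w).
  rewrite /Amu !(add_lfunE, scale_lfunE, id_lfunE).
  have muE : Num.conj (mu%:C : R[i]) = mu%:C.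
    by apply/eqP; rewrite eq_complex /= oppr0 !eqxx.
  by rewrite linearDl linearDr linearZl_LR linearZr_LR /= muE (proj1 hA).
have boundsRe v : m * complex.Re (bip v v) <= complex.Re (ip (Amu v) v) <=
    M * complex.Re (bip v v).
  have := bounds v; rewrite !lecE -!ReZ => /andP[/andP[_ ->] /andP[_ ->]].
  by [].
have Km v : m * complex.Re (bip v v) <= complex.Re (ip (Amu v) v).
  by have /andP[] := boundsRe v.
have KM v : complex.Re (ip (Amu v) v) <= M * complex.Re (bip v v).
  by have /andP[] := boundsRe v.
have K0 v : 0 <= complex.Re (ip (Amu v) v).
  exact: le_trans (mulr_ge0 (ltW m0) (inv_form_ge0 hB v)) (Km v).
have QY v := preconditioned_sqr_le hB v hK K0 M0 KM.
have zhat0 : zhat != 0.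
  by rewrite eq_complex /= negb_and subr0 (gt_eqF y0) orbT.
have [_ zhatE] := cargP zhat0; rewrite -/zeta in zhatE.
set k := cabs zhat in zhatE.
have k0 : 0 < k.
  rewrite lt_def cabs_ge0 andbT; apply: contra_neq zhat0 => k0.
  by rewrite zhatE k0 mul0r.
have GE : G = (B \o ((k%:C * expi zeta) *: \1 + Amu))%VF.
  rewrite -zhatE; congr (_ \o _)%VF; rewrite /Amu /zhat addrA -scalerDl subrK.
  by [].
have cosJ t : J t -> 0 < cos (zeta - t) /\ 0 < cos t.
  rewrite /J /= in_itv /= => /andP[t1 t2]; case/andP: zeta_bd => z1 z2.
  by split; apply: cos_gt0_pihalf; apply/andP; split; lra.
have L0 : 0 <= L by rewrite mulr_ge0 ?cabs_ge0 ?op_norm_ge0.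
have PX v : k ^+ 2 * complex.Re (ip (B v) v) <= L * (k * complex.Re (ip v v)).
  rewrite expr2 -/k -[L]/(k * _) -!mulrA ler_pM2l // mulrCA ler_pM2l //.
  exact: posdef_le_op_norm.
have [c10 c20] := cosJ _ Jphi; split.
  rewrite GE /alpha /rho /eps /nuz.
  (* L = 0 only when V is trivial; the bound on the cross term divides by L. *)
  have [v1|nontriv] := pselect (forall v : V, v = 0).
    apply: op_norm_le => [|v _]; first by rewrite /bip /inv_form !linear0r.
    rewrite (v1 v) linear0 /form_norm /bip /inv_form linear0r sqrtr0.
    exact: sqrtr_ge0.
  have [v0 /eqP v0n] : exists v : V, v <> 0 by apply/existsNP.
  have {}L0 : 0 < L.
    have := PX v0; have := posdef_gt0 hB v0n; have := dot_ge0 ip v0.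
    move=> vv0 Bv0 PXv; rewrite lt_def L0 andbT; apply/eqP => LE.
    by move: PXv; rewrite LE mul0r leNgt mulr_gt0 ?exprn_gt0.
  apply: op_norm_richardson_le => // [||v].
  - by apply: addr_gt0; apply: mulr_gt0.
  - exact: ltW.
  rewrite -zhatE image_sq // -/k; apply: sum_sq_le => // s.
  exact: young_cross_term.
move=> gamma phib Lb nub rhob alphab epsb g0 cross [Jphib phib_max].
have LbL : Lb <= L.
  by rewrite gerBl divr_ge0 ?mulr_ge0 // ltW.
have [d10 d20] := cosJ _ Jphib; split.
  rewrite GE /alphab /rhob /epsb /nub.
  apply: op_norm_richardson_le => // [||v].
  - by rewrite lt_max mulr_gt0.
  - exact: ltW.
  rewrite -zhatE image_sq // -/k.
  set c1 := cos _ in d10 *; set c2 := cos _ in d20 *.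
  set X := k * complex.Re (ip v v); set Y := complex.Re (ip (Amu v) v).
  have crossv : 2 * complex.Re (zhat * ip (B v) (Amu v)) <=
      - (2 * gamma / k * X).
    have := cross v; rewrite /bip !inv_formB // -(proj1 hB).
    have -> : 2 * gamma / k * X = 2 * (gamma * complex.Re (ip v v)).
      by rewrite /X; field; rewrite gt_eqF.
    by rewrite mulNr; lra.
  have X0 : 0 <= X by rewrite mulr_ge0 ?dot_ge0 // ltW.
  apply: (@le_trans _ _ (c1 * (Lb * c2 * X) + c2 * (M * c1 * Y))).
    have -> : c1 * (Lb * c2 * X) + c2 * (M * c1 * Y) =
      c1 * c2 * (M * Y - 2 * gamma / k * X + L * X) by rewrite /Lb -/k; ring.
    by rewrite ler_wpM2l ?(mulr_ge0 (ltW d10) (ltW d20)) // !lerD.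
  rewrite (mulrCA c1) (mulrCA c2) mulrDr.
  have c1X0 : 0 <= c1 * X by rewrite mulr_ge0 // ltW.
  have c2Y0 : 0 <= c2 * Y by rewrite mulr_ge0 ?K0 // ltW.
  by rewrite lerD // ler_wpM2r // le_max lexx ?orbT.
have nu_le : nuz phi <= nub phib.
  apply: le_trans (phib_max _ Jphi).
  rewrite /nuz /nub /nu /nu_breve ler_pM2l ?mulr_gt0 ?exprn_gt0 //.
  have d0 : 0 < M * cos (zeta - phi) by rewrite mulr_gt0.
  have Lc0 : 0 <= L * cos phi by rewrite mulr_ge0 // ltW.
  rewrite lef_pV2 ?posrE ?lt_max ?d0 ?(ltr_wpDr Lc0) // ge_max lerDl Lc0 /=.
  by rewrite (ler_wpDl (ltW d0)) // ler_wpM2r // ltW.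
by rewrite ler_wsqrtr // lerB.
Qed.
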